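(* Let $G$ be a group and $\phi$ a fixed-point free automorphism of $G$. Then the generalised Alexander quandle $\operatorname{Alex}(G,\phi)$ is a Dehn quandle; that is, there exist a group $H$ and a non-empty subset $A\subseteq H$ such that $\operatorname{Alex}(G,\phi)\cong\mathcal{D}(A^H)$ as quandles.
   Context: An automorphism of a group is fixed-point free if it does not fix any non-identity element of the group. For a group $G$ and $\phi\in\operatorname{Aut}(G)$, the generalised Alexander quandle $\operatorname{Alex}(G,\phi)$ is the set $G$ with the operation $x*y=\phi(xy^{-1})y$. For a group $H$ and a non-empty subset $A\subseteq H$, let $A^H$ be the set of all conjugates in $H$ of elements of $A$. The Dehn quandle $\mathcal{D}(A^H)$ is the set $A^H$ with the operation $x*y=yxy^{-1}$. *)

(* Defs.v *)
From mathcomp Require Import all_boot.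
From mathcomp Require Import boolp classical_sets.

Set Implicit Arguments.
Unset Strict Implicit.
Unset Printing Implicit Defensive.

Local Open Scope group_scope.
Local Open Scope classical_set_scope.

(* Right quandles: the maps x |-> x * y are the automorphisms. *)
Record quandle := Quandle {
  qcarrier :> Type;
  qop : qcarrier -> qcarrier -> qcarrier;
  qopxx : forall x, qop x x = x;
  qop_bij : forall y, bijective (fun x => qop x y);
  qopD : forall x y z, qop (qop x y) z = qop (qop x z) (qop y z)
}.

Definition quandle_isomorphic (Q R : quandle) : Prop :=
  exists2 f : Q -> R, bijective f & {morph f : x y / qop x y >-> qop x y}.

(* [groupType] is MathComp's type of arbitrary, possibly infinite, groups.  Its
   [choiceType] component is no restriction: by the classical axioms of
   [boolp], every type carries such a structure. *)
Record automorphism (G : groupType) := Automorphism {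
  aut_fun :> {multiplicative G -> G};
  aut_bij : bijective aut_fun
}.

Definition fixed_point_free (G : groupType) (phi : automorphism G) : Prop :=
  forall x : G, phi x = x -> x = 1.

Section Alexander.
Variables (G : groupType) (phi : automorphism G).

Definition alex_op (x y : G) : G := phi (x * y^-1) * y.

Lemma aut1 : phi 1 = 1.
Proof. by apply: (@mulgI _ (phi 1)); rewrite -gmulfM !mulg1. Qed.

Lemma autV (x : G) : phi x^-1 = (phi x)^-1.
Proof. by apply: (@mulgI _ (phi x)); rewrite -gmulfM !mulgV aut1. Qed.

Lemma alex_opxx x : alex_op x x = x.
Proof. by rewrite /alex_op mulgV aut1 mul1g. Qed.

Lemma alex_op_bij y : bijective (alex_op^~ y).
Proof.
have [psi phiK psiK] := aut_bij phi.
exists (fun x => psi (x * y^-1) * y) => x; rewrite /alex_op.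
  by rewrite mulgK phiK mulgVK.
by rewrite mulgK psiK mulgVK.
Qed.

Lemma alex_opD x y z :
  alex_op (alex_op x y) z = alex_op (alex_op x z) (alex_op y z).
Proof.
have phiF u v : phi u * (phi v)^-1 = phi (u * v^-1) by rewrite gmulfM autV.
rewrite /alex_op invgM !mulgA mulgK phiF invgM invgK !mulgA mulgVK.
by rewrite -!mulgA [phi (phi _ * _)]gmulfM -mulgA.
Qed.

Definition Alex : quandle := Quandle alex_opxx alex_op_bij alex_opD.

End Alexander.

Definition conjugates (H : groupType) (A : set H) : set H :=
  [set x | exists2 a, A a & exists h : H, x = h * a * h^-1].

Section Dehn.
Variables (H : groupType) (A : set H).

Lemma conjugatesJ (x h : H) :
  x \in conjugates A -> h * x * h^-1 \in conjugates A.
Proof.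
rewrite !inE => -[a Aa [k ->]].
by exists a => //; exists (h * k); rewrite invgM !mulgA.
Qed.

Definition dehn_conj (h : H) (x : conjugates A) : conjugates A :=
  exist _ (h * val x * h^-1) (conjugatesJ h (valP x)).

Definition dehn_op (x y : conjugates A) : conjugates A := dehn_conj (val y) x.

Lemma dehn_opxx x : dehn_op x x = x.
Proof. by apply: val_inj; rewrite /= mulgK. Qed.

Lemma dehn_op_bij y : bijective (dehn_op^~ y).
Proof.
exists (dehn_conj (val y)^-1) => x.
  by apply: val_inj; rewrite /= invgK !mulgA mulVg mul1g mulgVK.
by apply: val_inj; rewrite /= invgK !mulgA mulgV mul1g mulgK.
Qed.

Lemma dehn_opD x y z :
  dehn_op (dehn_op x y) z = dehn_op (dehn_op x z) (dehn_op y z).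
Proof. by apply: val_inj; rewrite /= !invgM invgK !mulgA !mulgVK. Qed.

Definition Dehn : quandle := Quandle dehn_opxx dehn_op_bij dehn_opD.

End Dehn.

(* [Dehn A] is the quandle D(A^H): the closure of A under conjugation is part
   of the definition. *)
Definition is_dehn_quandle (Q : quandle) : Prop :=
  exists (H : groupType) (A : set H),
    A !=set0 /\ quandle_isomorphic Q (Dehn A).

(* Main.v *)
From HB Require Import structures.
Require Import Defs.
From mathcomp Require Import all_boot.
From mathcomp Require Import boolp classical_sets.

(** A quandle [Q] acts on itself by the translations [R_y : x |-> x * y], which
    are automorphisms of [Q].  Any automorphism [s] satisfies
    [s R_y s^-1 = R_(s y)], because [s (x * y) = s x * s y]; so the set of all
    translations is closed under conjugation by the whole automorphism group
    [Aut Q], and (taking [s = R_z]) the map [y |-> R_y] turns the operation of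
    [Q] into conjugation.  Hence [Q] is the Dehn quandle of its translations,
    with [H = Aut Q], as soon as it is non-empty and faithful, meaning that
    [y |-> R_y] is injective ([faithful_is_dehn_quandle]).

    For [Alex phi] the translation [R_y] sends [1] to [phi(y)^-1 y].  If
    [R_y = R_z], comparing these values gives [phi (z y^-1) = z y^-1], so
    [y = z] when [phi] is fixed-point free ([alex_faithful]). *)

Set Implicit Arguments.
Unset Strict Implicit.
Unset Printing Implicit Defensive.

Local Open Scope group_scope.

(** * The automorphism group of a quandle *)

(** The inverse is stored as data so that the group operations are computed
    without choice; it is determined by the map, see [qaut_inj]. *)
Record qaut (Q : quandle) := QAut {
  qaut_fun :> Q -> Q;
  qaut_inv : Q -> Q;
  qaut_funK : cancel qaut_fun qaut_inv;
  qaut_invK : cancel qaut_inv qaut_fun;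
  qaut_morph : {morph qaut_fun : x y / qop x y}
}.

Section AutomorphismGroup.
Variable Q : quandle.
Implicit Types s t u : qaut Q.

Lemma qaut_inj s t : s =1 t -> s = t.
Proof.
case: s t => [f f' fK f'K fM] [g g' gK g'K gM] /= /funext eq_fg.
case: g / eq_fg in gK g'K gM *.
have eq_inv : f' = g' by apply/funext=> x; rewrite -[x in LHS]g'K fK.
case: g' / eq_inv in gK g'K *.
by congr QAut; apply: Prop_irrelevance.
Qed.

Definition qaut_id : qaut Q :=
  @QAut Q id id (fun=> erefl) (fun=> erefl) (fun _ _ => erefl).

Lemma qaut_inv_morph s : {morph qaut_inv s : x y / qop x y}.
Proof.
by move=> x y; apply: (can_inj (qaut_funK s)); rewrite qaut_morph !qaut_invK.
Qed.

Definition qaut_sym s : qaut Q :=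
  QAut (qaut_invK s) (qaut_funK s) (qaut_inv_morph s).

Lemma qaut_comp_morph s t : {morph s \o t : x y / qop x y}.
Proof. by move=> x y /=; rewrite !qaut_morph. Qed.

Definition qaut_comp s t : qaut Q :=
  QAut (can_comp (qaut_funK s) (qaut_funK t))
       (can_comp (qaut_invK t) (qaut_invK s)) (qaut_comp_morph s t).

Lemma qaut_compA : associative qaut_comp.
Proof. by move=> s t u; apply: qaut_inj. Qed.

Lemma qaut_comp1s : left_id qaut_id qaut_comp.
Proof. by move=> s; apply: qaut_inj. Qed.

Lemma qaut_comps1 : right_id qaut_id qaut_comp.
Proof. by move=> s; apply: qaut_inj. Qed.

Lemma qaut_compVs : left_inverse qaut_id qaut_sym qaut_comp.
Proof. by move=> s; apply: qaut_inj => x; apply: qaut_funK. Qed.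

Lemma qaut_compsV : right_inverse qaut_id qaut_sym qaut_comp.
Proof. by move=> s; apply: qaut_inj => x; apply: qaut_invK. Qed.

End AutomorphismGroup.

HB.instance Definition _ (Q : quandle) := gen_eqMixin (qaut Q).
HB.instance Definition _ (Q : quandle) := gen_choiceMixin (qaut Q).
HB.instance Definition _ (Q : quandle) := isGroup.Build (qaut Q)
  (@qaut_compA Q) (@qaut_comp1s Q) (@qaut_comps1 Q)
  (@qaut_compVs Q) (@qaut_compsV Q).

(** * Translations *)

Section Translations.
Variable Q : quandle.

(** A translation is an automorphism by [qop_bij] and [qopD]; the map is only
    known to be bijective, so its inverse as data comes from choice. *)
Lemma translation_subproof (y : Q) : {s : qaut Q | forall x, s x = qop x y}.
Proof.
apply: cid; have [g fK gK] := qop_bij y.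
by exists (QAut fK gK (fun x z => qopD x z y)).
Qed.

Definition translation (y : Q) : qaut Q := sval (translation_subproof y).

Lemma translationE (y x : Q) : translation y x = qop x y.
Proof. exact: (svalP (translation_subproof y)). Qed.

Lemma translationJ (s : qaut Q) (y : Q) :
  s * translation y * s^-1 = translation (s y).
Proof.
apply: (canLR (mulgK _)); apply: qaut_inj => x.
(* Multiplication in [qaut Q] is composition of maps. *)
change (s (translation y x) = translation (s y) (s x)).
by rewrite !translationE qaut_morph.
Qed.

Definition translations : set (qaut Q) := range translation.

(** By [translationJ]; this is why [H] is taken to be the automorphism group,
    in which the Dehn quandle contains nothing but the translations. *)
Lemma conjugates_translations : conjugates translations = translations.
Proof.
apply/seteqP; split=> [_ [_ [y _ <-] [s ->]]|_ [y _ <-]].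
  by rewrite translationJ; exists (s y).
by exists (translation y); [exists y | exists 1; rewrite invg1 mul1g mulg1].
Qed.

Lemma faithful_is_dehn_quandle (q : Q) :
  injective translation -> is_dehn_quandle Q.
Proof.
move=> tr_inj; exists (qaut Q), translations; split.
  by exists (translation q), q.
have in_conj y : translation y \in conjugates translations.
  by rewrite inE conjugates_translations; exists y.
have ex_index (a : conjugates translations) : {y | translation y = val a}.
  apply: cid; case: a => s /= /set_mem.
  by rewrite conjugates_translations => -[y _ <-]; exists y.
exists (fun y => exist _ (translation y) (in_conj y) : Dehn translations).
  exists (fun a => sval (ex_index a)) => [y|a].
    by apply: tr_inj; case: (ex_index _) => z /= ->.
  by apply: val_inj; case: (ex_index _) => z /= ->.
by move=> x y; apply: val_inj; rewrite /= translationJ translationE.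
Qed.

End Translations.

(** * Alexander quandles *)

Lemma alex_faithful (G : groupType) (phi : automorphism G) :
  fixed_point_free phi -> injective (@translation (Alex phi)).
Proof.
move=> phi_fpf y z eq_yz.
have : qop (1 : Alex phi) y = qop (1 : Alex phi) z.
  by rewrite -!translationE eq_yz.
rewrite /= /alex_op !mul1g !autV => eq1.
suff /phi_fpf /eqP : phi (z * y^-1) = z * y^-1 by rewrite divg_eq1 => /eqP.
by rewrite gmulfM autV -[(phi y)^-1](mulgK y) eq1 !mulgA mulgV mul1g.
Qed.

Theorem proposition3p12 (G : groupType) (phi : automorphism G) :
  fixed_point_free phi -> is_dehn_quandle (Alex phi).
Proof.
move=> phi_fpf; apply: (@faithful_is_dehn_quandle (Alex phi) (1 : G)).
exact: alex_faithful.
Qed.
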